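(* Let $(V,\mu,\alpha)$ be a Jordan-type Hom-Jordan algebra over a field $F$ with induced Jordan algebra $(V,\mu')$. (1) Let $(W,\alpha_W)$ be a $V$-bimodule of $(V,\mu,\alpha)$ with left structure map $\rho_l$ and right structure map $\rho_r$, written $a\cdot w=\rho_l(a\otimes w)$ and $w\cdot a=\rho_r(w\otimes a)$. Suppose that $\alpha_W$ is invertible and satisfies $\alpha_W(w\cdot a)=\alpha_W(w)\cdot\alpha(a)$ for all $a\in V$, $w\in W$. Then $W$ is a module of the induced Jordan algebra $(V,\mu')$ with the two compositions $w\cdot' a=\alpha_W^{-1}(w\cdot a)$ and $a\cdot' w=\alpha_W^{-1}(a\cdot w)$ for all $a\in V$, $w\in W$. (2) Let $W$ be a module of the induced Jordan algebra $(V,\mu')$ with two compositions $w\cdot' a$, $a\cdot' w$ for $a\in V$, $w\in W$. If there exists $\alpha_W\in\mathrm{End}(W)$ such that $\alpha_W(w\cdot' a)=\alpha_W(w)\cdot'\alpha(a)$ for all $a\in V$, $w\in W$, then $(W,\alpha_W)$ is a $V$-bimodule of $(V,\mu,\alpha)$ with left structure map $\rho_l:V\otimes W\to W$, $\rho_l(a\otimes w)=\alpha_W(a\cdot' w)$, and right structure map $\rho_r:W\otimes V\to W$, $\rho_r(w\otimes a)=\alpha_W(w\cdot' a)$.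
   Context: A Hom-Jordan algebra over a field $F$ is a triple $(V,\mu,\alpha)$ with $V$ a vector space, $\mu:V\times V\to V$ a commutative bilinear map and $\alpha:V\to V$ a linear map such that $\mu(\alpha^2(x),\mu(y,\mu(x,x)))=\mu(\mu(\alpha(x),y),\alpha(\mu(x,x)))$ for all $x,y\in V$. A Jordan algebra is a vector space with a commutative bilinear product $\circ$ such that $(x^2\circ y)\circ x=x^2\circ(y\circ x)$ for all $x,y$, where $x^2=x\circ x$. $(V,\mu,\alpha)$ is Jordan-type if there is a Jordan algebra $(V,\mu')$ with $\mu(x,y)=\alpha(\mu'(x,y))=\mu'(\alpha(x),\alpha(y))$ for all $x,y\in V$; $(V,\mu')$ is called the induced Jordan algebra. $V$-bimodule: for a Hom-Jordan algebra $(V,\mu,\alpha)$, a $V$-bimodule is a Hom-module $(W,\alpha_W)$ (a vector space $W$ with a linear map $\alpha_W:W\to W$) with linear maps $\rho_l:V\otimes W\to W$, $\rho_l(a\otimes w)=a\cdot w$, and $\rho_r:W\otimes V\to W$, $\rho_r(w\otimes a)=w\cdot a$, such that for all $a,b,c\in V$, $w\in W$: (i) $\rho_r\circ\tau_1=\rho_l$, where $\tau_1:V\otimes W\to W\otimes V$, $a\otimes w\mapsto w\otimes a$; (ii) $\alpha_W(w\cdot a)\cdot\alpha(\mu(b,c))+\alpha_W(w\cdot b)\cdot\alpha(\mu(c,a))+\alpha_W(w\cdot c)\cdot\alpha(\mu(a,b))=(\alpha_W(w)\cdot\mu(b,c))\cdot\alpha^2(a)+(\alpha_W(w)\cdot\mu(c,a))\cdot\alpha^2(b)+(\alpha_W(w)\cdot\mu(a,b))\cdot\alpha^2(c)$;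 (iii) $\alpha_W(w\cdot a)\cdot\alpha(\mu(b,c))+\alpha_W(w\cdot b)\cdot\alpha(\mu(c,a))+\alpha_W(w\cdot c)\cdot\alpha(\mu(a,b))=((w\cdot a)\cdot\alpha(b))\cdot\alpha^2(c)+((w\cdot c)\cdot\alpha(b))\cdot\alpha^2(a)+\mu(\mu(a,c),\alpha(b))\cdot\alpha_W^2(w)$. Jordan module: a module of a Jordan algebra $(J,\circ)$ is a vector space $W$ with two bilinear compositions $x\cdot a$, $a\cdot x$ in $W$ ($x\in W$, $a\in J$) such that for all $x\in W$, $a,b,c\in J$: (i) $a\cdot x=x\cdot a$; (ii) $(x\cdot a)\cdot(b\circ c)+(x\cdot b)\cdot(c\circ a)+(x\cdot c)\cdot(a\circ b)=(x\cdot(b\circ c))\cdot a+(x\cdot(c\circ a))\cdot b+(x\cdot(a\circ b))\cdot c$; (iii) $((x\cdot a)\cdot b)\cdot c+((x\cdot c)\cdot b)\cdot a+x\cdot((a\circ c)\circ b)=(x\cdot a)\cdot(b\circ c)+(x\cdot b)\cdot(c\circ a)+(x\cdot c)\cdot(a\circ b)$. *)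

(* Defs.v *)
From mathcomp Require Import all_boot all_order all_algebra.

Set Implicit Arguments.
Unset Strict Implicit.
Unset Printing Implicit Defensive.

Import GRing.Theory.

Local Open Scope ring_scope.

(* A linear map U (x) U' -> W out of a tensor product is given in curried form,
   as a bilinear map U -> U' -> W. *)
Definition bilinear_map (F : fieldType) (U U' W : lmodType F)
    (f : U -> U' -> W) : Prop :=
  bilinear_for *:%R *:%R f.

Record is_hom_jordan_algebra (F : fieldType) (V : lmodType F)
    (mu : V -> V -> V) (alpha : {linear V -> V}) : Prop := {
  hom_jordan_bilinear : bilinear_map mu;
  hom_jordan_comm : forall x y : V, mu x y = mu y x;
  hom_jordan_identity : forall x y : V,
    mu (alpha (alpha x)) (mu y (mu x x)) = mu (mu (alpha x) y) (alpha (mu x x))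
}.

Record is_jordan_algebra (F : fieldType) (V : lmodType F)
    (mul : V -> V -> V) : Prop := {
  jordan_bilinear : bilinear_map mul;
  jordan_comm : forall x y : V, mul x y = mul y x;
  jordan_identity : forall x y : V,
    mul (mul (mul x x) y) x = mul (mul x x) (mul y x)
}.

Record is_induced_jordan_algebra (F : fieldType) (V : lmodType F)
    (mu : V -> V -> V) (alpha : {linear V -> V}) (mu' : V -> V -> V) : Prop := {
  induced_jordan : is_jordan_algebra mu';
  induced_twist : forall x y : V, mu x y = alpha (mu' x y);
  induced_mult : forall x y : V, alpha (mu' x y) = mu' (alpha x) (alpha y)
}.


(* [rhol a w] is a . w and [rhor w a] is w . a. *)
Record is_hom_jordan_bimodule (F : fieldType) (V : lmodType F)
    (mu : V -> V -> V) (alpha : {linear V -> V})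
    (W : lmodType F) (alphaW : {linear W -> W})
    (rhol : V -> W -> W) (rhor : W -> V -> W) : Prop := {
  bimodule_left_bilinear : bilinear_map rhol;
  bimodule_right_bilinear : bilinear_map rhor;
  bimodule_sym : forall (a : V) (w : W), rhor w a = rhol a w;
  bimodule_ii : forall (a b c : V) (w : W),
    rhor (alphaW (rhor w a)) (alpha (mu b c))
    + rhor (alphaW (rhor w b)) (alpha (mu c a))
    + rhor (alphaW (rhor w c)) (alpha (mu a b))
    = rhor (rhor (alphaW w) (mu b c)) (alpha (alpha a))
      + rhor (rhor (alphaW w) (mu c a)) (alpha (alpha b))
      + rhor (rhor (alphaW w) (mu a b)) (alpha (alpha c));
  bimodule_iii : forall (a b c : V) (w : W),
    rhor (alphaW (rhor w a)) (alpha (mu b c))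
    + rhor (alphaW (rhor w b)) (alpha (mu c a))
    + rhor (alphaW (rhor w c)) (alpha (mu a b))
    = rhor (rhor (rhor w a) (alpha b)) (alpha (alpha c))
      + rhor (rhor (rhor w c) (alpha b)) (alpha (alpha a))
      + rhol (mu (mu a c) (alpha b)) (alphaW (alphaW w))
}.

(* [actr x a] is x . a and [actl a x] is a . x. *)
Record is_jordan_module (F : fieldType) (J : lmodType F)
    (mul : J -> J -> J) (W : lmodType F)
    (actr : W -> J -> W) (actl : J -> W -> W) : Prop := {
  module_right_bilinear : bilinear_map actr;
  module_left_bilinear : bilinear_map actl;
  module_sym : forall (a : J) (x : W), actl a x = actr x a;
  module_ii : forall (a b c : J) (x : W),
    actr (actr x a) (mul b c) + actr (actr x b) (mul c a)
    + actr (actr x c) (mul a b)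
    = actr (actr x (mul b c)) a + actr (actr x (mul c a)) b
      + actr (actr x (mul a b)) c;
  module_iii : forall (a b c : J) (x : W),
    actr (actr (actr x a) b) c + actr (actr (actr x c) b) a
    + actr x (mul (mul a c) b)
    = actr (actr x a) (mul b c) + actr (actr x b) (mul c a)
      + actr (actr x c) (mul a b)
}.

(* Main.v *)
Require Import Defs.
From mathcomp Require Import all_boot all_order all_algebra.

(** The Hom-products are obtained from the untwisted ones by applying the
    twisting maps once: [mu = alpha \o mu'] on the algebra, and
    [w . a = alphaW (w .' a)] on the module.  As [alpha] and [alphaW] are
    compatible with the products [mu'] and [.'], all twists occurring in a term
    can be pulled to the outside.  Every term of the two Hom-bimodule identities
    is balanced so that exactly three copies of [alphaW] come out; it is
    therefore the image under the cube of [alphaW] of the corresponding term of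
    the Jordan module identities.  This is the content of the lemmas [twist_*].

    Both halves of the theorem follow.  Applying the cube of [alphaW] to the
    identities of a Jordan module gives those of a Hom-bimodule.  Conversely,
    when [alphaW] is invertible, so is its cube, and it can be cancelled from
    the Hom-bimodule identities; the action [.'] is then recovered as
    [alphaW^-1 (w . a)]. *)

Set Implicit Arguments.
Unset Strict Implicit.
Unset Printing Implicit Defensive.

Import GRing.Theory.

Local Open Scope ring_scope.

Section Twist.

Context (F : fieldType) (V : lmodType F).
Context (mu : V -> V -> V) (alpha : {linear V -> V}) (mu' : V -> V -> V).
Context (hind : is_induced_jordan_algebra mu alpha mu').
Context (W : lmodType F) (alphaW : {linear W -> W}) (act : W -> V -> W).
Context (act_mult : forall (a : V) (w : W),
  alphaW (act w a) = act (alphaW w) (alpha a)).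

Local Notation alphaW3 x := (alphaW (alphaW (alphaW x))).
Local Notation rho w a := (alphaW (act w a)).

Lemma twist_act_mul (a b c : V) (w : W) :
  rho (alphaW (rho w a)) (alpha (mu b c)) = alphaW3 (act (act w a) (mu' b c)).
Proof. by rewrite (induced_twist hind) -!act_mult. Qed.

Lemma twist_mul_act (a b c : V) (w : W) :
  rho (rho (alphaW w) (mu b c)) (alpha (alpha a))
  = alphaW3 (act (act w (mu' b c)) a).
Proof. by rewrite (induced_twist hind) -!act_mult. Qed.

Lemma twist_act_act (a b c : V) (w : W) :
  rho (rho (rho w a) (alpha b)) (alpha (alpha c))
  = alphaW3 (act (act (act w a) b) c).
Proof. by rewrite -!act_mult. Qed.

(** This is the only term that needs [alpha] to be multiplicative for [mu']:
    the inner [alpha] of [mu (mu a c) (alpha b)] has to be pulled out of [mu']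
    before [alphaW] can absorb it. *)
Lemma twist_mul_mul (a b c : V) (w : W) :
  rho (alphaW (alphaW w)) (mu (mu a c) (alpha b))
  = alphaW3 (act w (mu' (mu' a c) b)).
Proof. by rewrite !(induced_twist hind) -(induced_mult hind) -!act_mult. Qed.

End Twist.

(** The inverse of a linear bijection is only given as a function, so its
    linearity is taken as a hypothesis. *)
Lemma bilinear_map_comp (F : fieldType) (U U' W W' : lmodType F)
    (g : W -> W') (f : U -> U' -> W) :
  linear g -> bilinear_map f -> bilinear_map (fun x y => g (f x y)).
Proof.
move=> g_lin [fl fr]; split=> [y c x x' | x c y y'] /=.
  by rewrite -g_lin; congr g; apply: fl.
by rewrite -g_lin; congr g; apply: fr.
Qed.

Theorem theorem5p5 (F : fieldType) (V : lmodType F)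
    (mu : V -> V -> V) (alpha : {linear V -> V}) (mu' : V -> V -> V)
    (hV : is_hom_jordan_algebra mu alpha)
    (hind : is_induced_jordan_algebra mu alpha mu') :
  (forall (W : lmodType F) (alphaW : {linear W -> W})
      (rhol : V -> W -> W) (rhor : W -> V -> W) (alphaWinv : W -> W),
    is_hom_jordan_bimodule mu alpha alphaW rhol rhor ->
    cancel alphaW alphaWinv -> cancel alphaWinv alphaW ->
    (forall (a : V) (w : W),
      alphaW (rhor w a) = rhor (alphaW w) (alpha a)) ->
    is_jordan_module mu'
      (fun (w : W) (a : V) => alphaWinv (rhor w a))
      (fun (a : V) (w : W) => alphaWinv (rhol a w)))
  /\
  (forall (W : lmodType F) (actr : W -> V -> W) (actl : V -> W -> W)
      (alphaW : {linear W -> W}),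
    is_jordan_module mu' actr actl ->
    (forall (a : V) (w : W),
      alphaW (actr w a) = actr (alphaW w) (alpha a)) ->
    is_hom_jordan_bimodule mu alpha alphaW
      (fun (a : V) (w : W) => alphaW (actl a w))
      (fun (w : W) (a : V) => alphaW (actr w a))).
Proof.
split.
  move=> W alphaW rhol rhor alphaWinv hW alphaK alphaVK rho_mult.
  have inv_lin : linear alphaWinv by apply: (can2_linear alphaK alphaVK).
  pose act w a := alphaWinv (rhor w a).
  have rhoE w a : rhor w a = alphaW (act w a) by rewrite /act alphaVK.
  have act_mult a w : alphaW (act w a) = act (alphaW w) (alpha a).
    by rewrite /act -rho_mult alphaK alphaVK.
  have cube_inj : injective (fun x => alphaW (alphaW (alphaW x))).
    by move=> x y /(can_inj alphaK) /(can_inj alphaK) /(can_inj alphaK).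
  split.
  - exact: bilinear_map_comp inv_lin (bimodule_right_bilinear hW).
  - exact: bilinear_map_comp inv_lin (bimodule_left_bilinear hW).
  - by move=> a w; rewrite (bimodule_sym hW).
  - move=> a b c w; rewrite -!/(act _ _); apply: cube_inj.
    have := bimodule_ii hW a b c w; rewrite !rhoE !linearD.
    by rewrite !(twist_act_mul hind act_mult) !(twist_mul_act hind act_mult).
  - move=> a b c w; rewrite -!/(act _ _); apply: cube_inj; symmetry.
    have := bimodule_iii hW a b c w; rewrite -(bimodule_sym hW) !rhoE !linearD.
    by rewrite !(twist_act_mul hind act_mult) !(twist_act_act act_mult)
      (twist_mul_mul hind act_mult).
move=> W actr actl alphaW hW act_mult; split.
- exact: bilinear_map_comp (linearP alphaW) (module_left_bilinear hW).
- exact: bilinear_map_comp (linearP alphaW) (module_right_bilinear hW).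
- by move=> a w; rewrite (module_sym hW).
- move=> a b c w.
  rewrite !(twist_act_mul hind act_mult) !(twist_mul_act hind act_mult).
  by rewrite -!linearD (module_ii hW).
- move=> a b c w; rewrite (module_sym hW).
  rewrite !(twist_act_mul hind act_mult) !(twist_act_act act_mult).
  by rewrite (twist_mul_mul hind act_mult) -!linearD (module_iii hW).
Qed.
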